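(* Let $p\in[1,+\infty)$. A set $E\subseteq\ell_p$ is determining for the class $\mathrm{SSC}(\ell_p)$ of all strongly separately continuous functions $f:\ell_p\to\mathbb R$ if and only if $E$ is super dense in $\ell_p$.
   Context: $\ell_p$ is the space of all real sequences $x=(x_n)_{n=1}^\infty$ with $\sum_{n=1}^\infty|x_n|^p<\infty$, with the topology of the norm $\|x\|_p=(\sum_{n=1}^\infty|x_n|^p)^{1/p}$. Strong separate continuity: for $x,a\in\ell_p$ and $k\in\mathbb N$, let $x_k^a$ be the sequence obtained from $x$ by replacing its $k$-th coordinate $x_k$ by $a_k$. A function $f:\ell_p\to\mathbb R$ is strongly separately continuous if for every $a\in\ell_p$ and every $k\in\mathbb N$ one has $\lim_{x\to a}|f(x)-f(x_k^a)|=0$, where $x\to a$ in the norm topology. $\mathrm{SSC}(\ell_p)$ is the set of all such functions. Determining set: $E\subseteq \ell_p$ is determining for $\mathrm{SSC}(\ell_p)$ if for all $f,g\in\mathrm{SSC}(\ell_p)$ the equality $f|_E=g|_E$ implies $f=g$ on $\ell_p$. Components: for $a\in\ell_p$ let $\sigma(a)$ be the set of all sequences $y$ that differ from $a$ in at most finitely many coordinates (then $\sigma(a)\subseteq\ell_p$). The distinct sets $\sigma(a)$, $a\in\ell_p$, form a partition $(\sigma_i:i\in I)$ of $\ell_p$; they are called the $\mathcal S$-components of $\ell_p$. Nearly open sets: a set $W\subseteq\sigma(a)$ is nearly open in $\sigma(a)$ if for every finite set $T_0\subseteq\mathbb N$ the set $W_{T_0}=\{x\in\mathbb R^{T_0}: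 a_{T_0}^x\in W\}$ is open in $\mathbb R^{T_0}$ (usual topology), where $a_{T_0}^x$ is the sequence whose $t$-th coordinate is $x_t$ for $t\in T_0$ and $a_t$ for $t\notin T_0$. (This does not depend on the choice of the base point $a$ of the component.) Super dense sets: for $A\subseteq\sigma(a)$ put $\overline{A}^{\bullet}=\{x\in\sigma(a): W\cap A\neq\emptyset$ for every nearly open $W\subseteq \sigma(a)$ with $x\in W\}$; $A$ is super dense in $\sigma(a)$ if $\overline{A}^{\bullet}=\sigma(a)$. A set $E\subseteq\ell_p$ is called super dense in $\ell_p$ if for every $i\in I$ the set $E\cap\sigma_i$ is super dense in $\sigma_i$ whenever $E\cap\sigma_i\neq\emptyset$.
   Formalization: The formal right-hand side also requires E to meet every component σ_i; without this the claim fails: E = ∅ (or a single component) is super dense as defined, but not determining, since the constants 0 and 1 (or a component's indicator and 1) agree on it. *)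

(* Defs.v *)
From HB Require Import structures.
From mathcomp Require Import all_boot all_order all_algebra finmap.
From mathcomp Require Import all_classical all_reals all_analysis.
Import Order.TTheory GRing.Theory Num.Theory.
Import numFieldNormedType.Exports.

Set Implicit Arguments.
Unset Strict Implicit.
Unset Printing Implicit Defensive.

Local Open Scope classical_set_scope.
Local Open Scope ring_scope.

(* Sequences are indexed from 0.  The space l_p is a set of sequences, and a
   function l_p -> R is a total function on sequences of which only the values
   on [lp p] are ever used. *)
Definition lp {R : realType} (p : R) : set (nat -> R) :=
  [set x | cvgn (series (fun n => `|x n| `^ p))].

Definition lp_norm {R : realType} (p : R) (x : nat -> R) : R :=
  (limn (series (fun n => `|x n| `^ p))) `^ p^-1.

Definition lp_nbhs {R : realType} (p : R) (a : nat -> R) :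
    set_system (nat -> R) :=
  filter_from [set e : R | 0 < e]
    (fun e => [set x | lp p x /\ lp_norm p (x \- a) < e]).

(* The sequence written $x_k^a$. *)
Definition replace {R : realType} (k : nat) (a x : nat -> R) : nat -> R :=
  fun n => if n == k then a k else x n.

Definition strongly_separately_continuous {R : realType} (p : R)
    (f : (nat -> R) -> R) : Prop :=
  forall (a : nat -> R) (k : nat), lp p a ->
    `|f x - f (replace k a x)| @[x --> lp_nbhs p a] --> (0 : R).

Definition determining {R : realType} (p : R) (E : set (nat -> R)) : Prop :=
  forall f g : (nat -> R) -> R,
    strongly_separately_continuous p f ->
    strongly_separately_continuous p g ->
    (forall x, E x -> f x = g x) ->
    forall x, lp p x -> f x = g x.

Definition sigma {R : realType} (a : nat -> R) : set (nat -> R) :=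
  [set y | finite_set [set n | y n <> a n]].

(* The sequence written $a_{T_0}^x$, for x in R^{T_0}. *)
Definition override {R : realType} (T0 : {fset nat}) (a : nat -> R)
    (x : T0 -> R) : nat -> R :=
  fun n => if (insub n : option T0) is Some t then x t else a n.

(* W is nearly open in [sigma a]; used only for W included in [sigma a]. *)
Definition nearly_open {R : realType} (a : nat -> R) (W : set (nat -> R)) :
    Prop :=
  forall T0 : {fset nat},
    open [set x : {ptws T0 -> R} | W (@override R T0 a x)].

Definition nearly_closure {R : realType} (a : nat -> R) (A : set (nat -> R)) :
    set (nat -> R) :=
  [set x | sigma a x /\
    forall W : set (nat -> R), W `<=` sigma a -> nearly_open a W -> W x ->
      W `&` A !=set0].

Definition super_dense_in {R : realType} (a : nat -> R) (A : set (nat -> R)) :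
    Prop :=
  nearly_closure a A = sigma a.

(* The components are the sets [sigma a] with a in l_p.  A component disjoint
   from E is unconstrained, so the empty set is super dense. *)
Definition super_dense {R : realType} (p : R) (E : set (nat -> R)) : Prop :=
  forall a : nat -> R, lp p a ->
    E `&` sigma a !=set0 -> super_dense_in a (E `&` sigma a).

(* Main.v *)
(* Replacing coordinates one at a time shows that a strongly separately
   continuous function is continuous on every finite-dimensional slice of a
   component, so two such functions differ on a nearly open set; this set meets
   E as soon as it is nonempty and E is super dense.

   Conversely, the indicator of a component is strongly separately continuous,
   which forces E to meet every component.  A nearly open set W around c
   contains a box |x n - c n| <= e n with all e n > 0 (the nearly open topology
   is the box topology, since there are countably many coordinates), and the
   infimum over n of the tents max(0, 1 - |x n - c n| / e n) is a strongly
   separately continuous function that is positive at c and vanishes off W.  So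
   E must meet W. *)
Require Import Defs.
From mathcomp Require Import all_boot all_order all_algebra.
From mathcomp Require Import all_classical all_reals all_analysis.
From mathcomp Require Import finmap lra.
Import Order.TTheory GRing.Theory Num.Theory.
Import numFieldNormedType.Exports.

Set Implicit Arguments.
Unset Strict Implicit.

Local Open Scope classical_set_scope.
Local Open Scope ring_scope.

(** * Tails of series and membership in a component *)

Lemma cvg_series_eventually {R : realType} (u v : nat -> R) (N : nat) :
  (forall n, (N <= n)%N -> u n = v n) -> cvgn (series u) -> cvgn (series v).
Proof.
move=> uv; rewrite -(is_cvg_series_restrict N u) -(is_cvg_series_restrict N v).
have -> // : [sequence \sum_(N <= k < n) u k]_n =
             [sequence \sum_(N <= k < n) v k]_n.
by apply: funext => n; apply: eq_big_nat => k /andP[Nk _]; exact: uv.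
Qed.

Lemma limn_series_finite {R : realType} (u : nat -> R) (N : nat) :
  (forall n, (N <= n)%N -> u n = 0) ->
  limn (series u) = \sum_(0 <= k < N) u k.
Proof.
move=> u0; apply: lim_near_cst => //; near=> n.
have Nn : (N <= n)%N by near: n; exact: nbhs_infty_ge.
rewrite /series/= (big_cat_nat (leq0n N) Nn)/=.
rewrite [X in _ + X]big_nat_cond [X in _ + X]big1 ?addr0//.
by move=> k /andP[/andP[Nk _] _]; exact: u0.
Unshelve. all: by end_near. Qed.

Lemma finite_set_nat_bounded (A : set nat) :
  finite_set A -> exists N, forall n, (N <= n)%N -> ~ A n.
Proof.
move=> /finite_seqP[s ->]; exists (\max_(k <- s) k).+1 => n sn /= ns.
by have := @leq_bigmax_seq _ s xpredT id n ns isT; rewrite leqNgt sn.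
Qed.

Lemma sigma_eventually {R : realType} (a x : nat -> R) :
  sigma a x -> exists N, forall n, (N <= n)%N -> x n = a n.
Proof.
move=> /finite_set_nat_bounded[N hN]; exists N => n /hN /=.
by apply: contra_notP.
Qed.

Lemma eventually_sigma {R : realType} (a x : nat -> R) N :
  (forall n, (N <= n)%N -> x n = a n) -> sigma a x.
Proof.
move=> xa; apply: (sub_finite_set _ (finite_II N)) => n /= xan.
by rewrite ltnNge; apply/negP => /xa.
Qed.

Lemma sigma_lp {R : realType} (p : R) (a x : nat -> R) :
  lp p a -> sigma a x -> lp p x.
Proof.
move=> pa /sigma_eventually[N xa].
by apply: (@cvg_series_eventually _ _ _ N _ pa) => n /xa ->.
Qed.

Lemma sigma_replace {R : realType} (a b x : nat -> R) k :
  sigma a (replace k b x) <-> sigma a x.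
Proof.
split=> /sigma_eventually[N xa]; apply: (@eventually_sigma _ _ _ (maxn N k.+1));
  move=> n; rewrite geq_max => /andP[/xa + kn]; rewrite /replace;
  by rewrite gtn_eqF.
Qed.

(** * The norm of [lp] and its neighbourhood filters *)

Lemma powR_normB_le {R : realType} (p u v : R) : 0 <= p ->
  `|u - v| `^ p <= 2 `^ p * (`|u| `^ p + `|v| `^ p).
Proof.
move=> p0; have h := ler_normB u v.
(* Used with the larger of [|u|] and [|v|], since [|u - v|] is at most twice that one; no convexity
   of the power enters. *)
have le_pow (w : R) : `|u - v| <= 2 * `|w| ->
    `|u - v| `^ p <= 2 `^ p * `|w| `^ p.
  by move=> uvw; rewrite -powRM//; apply: ge0_ler_powR => //;
    rewrite nnegrE// mulr_ge0.
have [uv|/ltW vu] := leP `|u| `|v|.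
  apply: (le_trans (le_pow v _)); first by lra.
  by apply: ler_wpM2l; rewrite ?powR_ge0// lerDr powR_ge0.
apply: (le_trans (le_pow u _)); first by lra.
by apply: ler_wpM2l; rewrite ?powR_ge0// lerDl powR_ge0.
Qed.

Lemma lp_sub {R : realType} (p : R) (x y : nat -> R) :
  0 <= p -> lp p x -> lp p y -> lp p (x \- y).
Proof.
move=> p0 px py.
apply: (@series_le_cvg _ _
  (fun n => (2 `^ p) * (`|x n| `^ p + `|y n| `^ p))).
- by move=> n; exact: powR_ge0.
- by move=> n; rewrite mulr_ge0 ?addr_ge0 ?powR_ge0.
- by move=> n; exact: powR_normB_le.
- exact: is_cvg_seriesZ (is_cvg_seriesD px py).
Qed.

Lemma coord_le_lp_norm {R : realType} (p : R) (x : nat -> R) k :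
  0 < p -> lp p x -> `|x k| <= lp_norm p x.
Proof.
move=> p0 px; set u := fun n => `|x n| `^ p.
have u0 n : 0 <= u n by exact: powR_ge0.
have nd : nondecreasing_seq (series u).
  by apply: nondecreasing_series => n _ _.
have le_u : u k <= limn (series u).
  apply: le_trans (nondecreasing_cvgn_le nd px k.+1).
  by rewrite seriesSr lerDr; apply: sumr_ge0.
have -> : `|x k| = u k `^ p^-1.
  by rewrite /u -powRrM divff ?gt_eqF// powRr1.
rewrite /lp_norm; apply: ge0_ler_powR; rewrite ?nnegrE ?invr_ge0 ?(ltW p0)//.
exact: le_trans le_u.
Qed.

Lemma lp_nbhs_filter {R : realType} (p : R) (a : nat -> R) :
  Filter (lp_nbhs p a).
Proof.
apply: filter_from_filter; first by exists 1; exact: ltr01.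
move=> e d /= e0 d0; exists (Num.min e d); first by rewrite lt_min e0.
move=> x /= [px xed].
have /andP[xe xd] : (lp_norm p (x \- a) < e) && (lp_norm p (x \- a) < d).
  by rewrite -lt_min.
by split; split.
Qed.
#[export] Existing Instance lp_nbhs_filter.

Lemma lp_nbhs_coord {R : realType} (p : R) (a : nat -> R) k :
  0 < p -> lp p a -> x k @[x --> lp_nbhs p a] --> a k.
Proof.
move=> p0 pa; apply/cvgrPdist_lt => e e0; exists e => // x [px xe].
have pxa : lp p (x \- a) by apply: lp_sub => //; exact: ltW.
by rewrite distrC; exact: le_lt_trans (coord_le_lp_norm k p0 pxa) xe.
Qed.

(** * Continuity along finite-dimensional slices *)

Lemma cvg_lp_nbhs {R : realType} (p : R) (I : Type) (F : set_system I)
    (FF : Filter F) (b : nat -> R) (z : I -> nat -> R) (N : nat) :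
  0 < p -> lp p b -> (forall i n, (N <= n)%N -> z i n = b n) ->
  (forall n, z i n @[i --> F] --> b n) ->
  z i @[i --> F] `=>` lp_nbhs p b.
Proof.
move=> p0 pb zb zcvg A [e /= e0 eA].
(* [N] terms of size at most [d ^ p] add up to [N / (N + 1)] times [e ^ p]; the successor keeps the
   bound strict and covers [N = 0]. *)
pose d := (e `^ p / N.+1%:R) `^ p^-1.
have ep0 : 0 < e `^ p by exact: powR_gt0.
have d0 : 0 < d by apply: powR_gt0; apply: divr_gt0.
have dp : d `^ p = e `^ p / N.+1%:R.
  by rewrite -powRrM mulVf ?gt_eqF// powRr1// ltW// divr_gt0.
have near_d : \forall i \near F, forall n : 'I_N, `|z i n - b n| < d.
  apply: filter_forall => n.
  by have /cvgrPdist_lt/(_ _ d0) := zcvg n; apply: filterS => i; rewrite distrC.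
rewrite /fmap /=; apply: filterS near_d => i zd; apply: eA; split.
  by apply: (sigma_lp pb); apply: (@eventually_sigma _ _ _ N) => n; exact: zb.
rewrite /lp_norm (@limn_series_finite _ _ N); last first.
  by move=> n Nn; rewrite /= zb// subrr normr0 powR0// gt_eqF.
have -> : e = (e `^ p) `^ p^-1 by rewrite -powRrM divff ?gt_eqF// powRr1// ltW.
have s0 : 0 <= \sum_(0 <= k < N) `|(z i \- b) k| `^ p.
  by apply: sumr_ge0 => k _; exact: powR_ge0.
apply: gt0_ltr_powR; rewrite ?nnegrE ?invr_gt0 ?(ltW ep0)//.
apply: (@le_lt_trans _ _ (\sum_(0 <= k < N) d `^ p)).
  rewrite big_nat [leRHS]big_nat; apply: ler_sum => k /andP[_ kN].
  apply: ge0_ler_powR; rewrite ?nnegrE ?(ltW p0) ?(ltW d0)//.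
  exact/ltW/(zd (Ordinal kN)).
have ltN : e `^ p / N.+1%:R * N%:R < e `^ p.
  by rewrite mulrAC ltr_pdivrMr// ltr_pM2l// ltr_nat.
by rewrite sumr_const_nat subn0 dp -[ltLHS]mulr_natr.
Qed.

Lemma ssc_cvg_slice {R : realType} (p : R) (f : (nat -> R) -> R)
    (I : Type) (F : set_system I) (FF : Filter F) (b : nat -> R)
    (z : I -> nat -> R) (N : nat) :
  0 < p -> strongly_separately_continuous p f -> lp p b ->
  (forall i n, (N <= n)%N -> z i n = b n) ->
  (forall n, z i n @[i --> F] --> b n) ->
  f (z i) @[i --> F] --> f b.
Proof.
move=> p0 sf pb zb zcvg.
(* [mix] interpolates from [z i] at [m = 0] to [b] at [m = N], so [f (z i) - f b] telescopes into
   single replacements. *)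
pose mix m (y : nat -> R) : nat -> R := fun n => if (n < m)%N then b n else y n.
have mixS m y : mix m.+1 y = replace m b (mix m y).
  apply: funext => n; rewrite /mix /replace ltnS leq_eqVlt.
  by have [->|] := eqVneq n m.
have mix_cvg m : f (z i) - f (mix m (z i)) @[i --> F] --> (0 : R).
  elim: m => [|m IH].
    by apply: cvg_near_cst; apply: nearW => i; rewrite subrr.
  (* Strong separate continuity at [b] only concerns points tending to [b] in norm, so each
     intermediate point must do so too. *)
  have zm : mix m (z i) @[i --> F] `=>` lp_nbhs p b.
    apply: (@cvg_lp_nbhs _ _ _ _ _ _ _ N) => // [i n Nn|n]; rewrite /mix.
      by case: ifP => // _; exact: zb.
    by case: (n < m)%N; [exact: cvg_cst|exact: zcvg].
  have step : f (mix m (z i)) - f (mix m.+1 (z i)) @[i --> F] --> (0 : R).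
    apply/norm_cvg0P.
    have := cvg_comp _ _ zm (sf b m pb); apply: cvg_trans; apply: near_eq_cvg.
    by apply: nearW => i /=; rewrite mixS.
  rewrite -(addr0 0); apply: cvg_trans (cvgD IH step); apply: near_eq_cvg.
  by apply: nearW => i /=; rewrite addrA subrK.
have mixN i : mix N (z i) = b.
  by apply: funext => n; rewrite /mix; case: ltnP => // /zb.
rewrite -(add0r (f b)).
apply: cvg_trans (cvgD (mix_cvg N) (@cvg_cst _ (f b) _ F FF)).
apply: near_eq_cvg; apply: nearW => i.
by transitivity (f (z i) - f (mix N (z i)) + f b) => //; rewrite mixN subrK.
Qed.

(** * Nearly open sets and the boxes they contain *)

Lemma cvg_ptws (T : choiceType) (V : topologicalType) (I : Type)
    (F : set_system I) (FF : Filter F) (f : I -> T -> V) (l : T -> V) :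
  (forall t, f i t @[i --> F] --> l t) -> {ptws, f @ F --> l}.
Proof.
move=> h; apply/cvg_sup => t A; rewrite nbhsE => -[B [[C oC <-] Cl] BA].
by rewrite /fmap /=; apply: (filterS BA); apply: (h t); exact: open_nbhs_nbhs.
Qed.

(** Replacement is jointly continuous in the point and the new value, and gives back [x] at
    [(x, x n)]. This is the local hypothesis of the near-covering form of compactness. *)
Lemma replace_near {R : realType} (n : nat) (x : {ptws nat -> R})
    (U : set {ptws nat -> R}) :
  open U -> U x ->
  \forall x' \near x & t \near x n, U (replace n (fun=> t) x').
Proof.
move=> oU Ux.
pose upd (q : {ptws nat -> R} * R) : nat -> R := replace n (fun=> q.2) q.1.
have upd_cvg : {ptws, upd @ filter_prod (nbhs x) (nbhs (x n)) --> x}.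
  have FF : Filter (filter_prod (nbhs x) (nbhs (x n))).
    exact: filter_prod_filter.
  apply: (@cvg_ptws _ _ _ _ FF upd x) => k.
  rewrite /upd /replace; have [->|_] := eqVneq k n; first exact: cvg_snd.
  have xk := @proj_continuous nat (fun=> R) k x.
  by apply: (cvg_comp (@fst {ptws nat -> R} R) _ _ xk); exact: cvg_fst.
by apply: (upd_cvg U); exact: open_nbhs_nbhs.
Qed.

Section NearlyOpenBox.
Context {R : realType} (a c : nat -> R) (W : set (nat -> R)).
Hypotheses (ac : sigma a c) (oW : nearly_open a W) (Wc : W c).

Let box (r : nat -> R) : set {ptws nat -> R} :=
  [set x | forall n, `|x n - c n| <= r n].

Let box_compact r : compact (box r).
Proof.
pose A n : set R := `[c n - r n, c n + r n]%classic.
have -> : box r = [set x | forall n, A n (x n)].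
  by apply/seteqP; split => x + n => /(_ n); rewrite /A /= in_itv/= ler_distl.
by apply: (@tychonoff nat (fun=> R) A) => n; exact: segment_compact.
Qed.

(** A tube lemma: vanishing radii from [n] on confine the box to one finite-dimensional slice, where
    [W] is open, and compactness gives a single [d] for all its points. *)
Let box_extend n r : (forall k, (n <= k)%N -> r k = 0) -> box r `<=` W ->
  exists2 d, 0 < d & box (fun k => if k == n then d else r k) `<=` W.
Proof.
move=> r0 rW; have [N cN] := sigma_eventually ac.
(* [T0] holds coordinate [n] and every coordinate where a point of the box can differ from [a]. *)
pose T0 : {fset nat} := seq_fset tt (iota 0 (maxn N n.+1)).
pose restr (x : {ptws nat -> R}) : {ptws T0 -> R} := fun t => x (val t).
have ovE x : (forall k, (maxn N n.+1 <= k)%N -> x k = a k) ->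
    override a (restr x) = x.
  move=> xa; apply: funext => k; rewrite /override; case: insubP => [t _ <-//|].
  by rewrite seq_fsetE mem_iota /= add0n -leqNgt => /xa.
(* [U] is open in the full product and agrees with [W] on points equal to [a] off [T0]. *)
pose U : set {ptws nat -> R} := [set x | W (override a (restr x))].
have oU : open U.
  apply: (@open_comp _ _ restr) (oW T0) => x _.
  by apply: (cvg_ptws (nbhs_filter x)) => t;
    exact: (@proj_continuous nat (fun=> R) (val t) x).
have box_far x k : box r x -> (n <= k)%N -> x k = c k.
  move=> /(_ k) + nk; rewrite (r0 _ nk) normr_le0 subr_eq0 => /eqP //.
have far_a x k : box r x -> (maxn N n.+1 <= k)%N -> x k = a k.
  move=> rx; rewrite geq_max => /andP[/cN <- nk].
  by apply: box_far => //; exact: ltnW.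
have : \forall t \near c n, box r `<=` (fun x => U (replace n (fun=> t) x)).
  have /compact_near_coveringP covr := box_compact (r := r).
  apply: (covr R (nbhs (c n)) (fun t x => U (replace n (fun=> t) x))) => x rx.
  rewrite -(box_far x n rx)//; apply: replace_near oU _.
  by rewrite /U/= ovE; [exact: (rW _ rx)|move=> k; exact: (far_a _ _ rx)].
move=> /nbhs_closedballP[d dU]; exists d%:num => // y yd.
(* A point of the enlarged box is a point of the old one with coordinate [n] reset. *)
have ry : box r (replace n c y).
  move=> k; rewrite /replace; have := yd k.
  by have [->|//] := eqVneq k n; rewrite subrr normr0 r0.
have yE : replace n (fun=> y n) (replace n c y) = y.
  by apply: funext => k; rewrite /replace; case: eqVneq => // ->.
have := dU (y n) _ _ ry; rewrite /U/= yE ovE; first apply.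
  by rewrite closed_ballE//= /closed_ball_/= distrC; have := yd n; rewrite eqxx.
move=> k mk; rewrite -(far_a _ _ ry mk) /replace; case: eqVneq mk => // ->.
by rewrite geq_max ltnn andbF.
Qed.

(* Compactness of the boxes with finitely many nonzero radii makes it possible
   to open up one more coordinate at each step. *)
Lemma nearly_open_box : exists2 e : nat -> R, (forall n, 0 < e n) &
  forall x, sigma a x -> (forall n, `|x n - c n| <= e n) -> W x.
Proof.
(* The radius is a dummy [1] where [box_extend] does not apply, so that choice ranges over all
   pairs. *)
have /choice[d dP] : forall nr : nat * (nat -> R), exists d, 0 < d /\
    ((forall k, (nr.1 <= k)%N -> nr.2 k = 0) -> box nr.2 `<=` W ->
     box (fun k => if k == nr.1 then d else nr.2 k) `<=` W).
  move=> [n r] /=; have [h|h] := pselect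
      ((forall k, (n <= k)%N -> r k = 0) /\ box r `<=` W).
    by have [d d0 dW] := box_extend (proj1 h) (proj2 h); exists d.
  by exists 1; split => // r0 rW; exfalso; exact: h.
(* Stage [0] is the point [c]; stage [m.+1] opens coordinate [m], whose radius never changes again.
   The final radii are thus read off the diagonal. *)
pose fix r n : nat -> R :=
  if n is m.+1 then fun k => if k == m then d (m, r m) else r m k else fun=> 0.
have r0 n k : (n <= k)%N -> r n k = 0.
  elim: n => //= n IH nk; rewrite gtn_eqF// IH//; exact: ltnW.
have rW n : box (r n) `<=` W.
  elim: n => [x x0|n IH]; last first.
    exact: (proj2 (dP (n, r n)) (r0 n) IH).
  suff -> : x = c by [].
  apply: funext => k; have := x0 k.
  by rewrite /= normr_le0 subr_eq0 => /eqP.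
exists (fun n => d (n, r n)) => [n|x ax xe]; first exact: (proj1 (dP (n, r n))).
have rE n k : (k < n)%N -> r n k = d (k, r k).
  elim: n => //= n IH; rewrite ltnS leq_eqVlt.
  by have [->|_ /IH] := eqVneq k n.
(* Both [x] and [c] equal [a] from some index on, so [x] already lies in the box of a finite
   stage. *)
have [N1 cN] := sigma_eventually ac; have [N2 xN] := sigma_eventually ax.
apply: (rW (maxn N1 N2)) => k; case: (ltnP k (maxn N1 N2)) => [kN|Nk].
  by rewrite rE.
rewrite r0//; move: Nk; rewrite geq_max => /andP[/cN -> /xN ->].
by rewrite subrr normr0.
Qed.

End NearlyOpenBox.

Lemma ssc_neq_nearly_open {R : realType} (p : R) (f g : (nat -> R) -> R)
    (a : nat -> R) :
  0 < p -> lp p a -> strongly_separately_continuous p f ->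
  strongly_separately_continuous p g ->
  nearly_open a (sigma a `&` [set x | f x != g x]).
Proof.
move=> p0 pa sf sg T0; rewrite openE => x /= [ax fgx].
have FF : Filter (nbhs (x : {ptws T0 -> R})) by exact: nbhs_filter.
have [N NT] : exists N, forall n, (N <= n)%N -> n \notin T0.
  have [N NT] := finite_set_nat_bounded (finite_fset T0).
  by exists N => n /NT /negP.
have far (y : T0 -> R) n : (N <= n)%N -> override a y n = a n.
  by move=> /NT nT; rewrite /override; case: insubP => // t; rewrite (negbTE nT).
have sov y : sigma a (@override R T0 a y) by exact: eventually_sigma (far y).
have cvgh (h : (nat -> R) -> R) : strongly_separately_continuous p h ->
    h (@override R T0 a y) @[y --> (x : {ptws T0 -> R})] --> h (override a x).
  move=> sh; apply: (ssc_cvg_slice FF p0 sh (sigma_lp pa (sov x)) (N := N)).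
  - by move=> y n Nn; rewrite !far.
  - move=> n; rewrite /override; case: insubP => [t _ _|_]; last exact: cvg_cst.
    exact: (@proj_continuous T0 (fun=> R) t x).
have fgx0 : f (override a x) - g (override a x) != 0 by rewrite subr_eq0.
have N0 := cvgr_neq0 _ (cvgB (cvgh f sf) (cvgh g sg)) fgx0.
apply: (@filterS _ _ FF _ _ _ (N0 FF FF)) => y yN0.
split; first exact: sov.
by rewrite /= -subr_eq0.
Qed.

(** * Bump functions supported in a box *)

Section BoxBump.
Context {R : realType} (a c e : nat -> R).
Hypothesis e0 : forall n, 0 < e n.

Let tent (x : nat -> R) : set R :=
  range (fun n => Num.max 0 (1 - `|x n - c n| / e n)).

(* The infimum (rather than the product) of one-coordinate tents is Lipschitz
   in each coordinate, and is defined on all of [sigma a]. *)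
Definition box_bump (x : nat -> R) : R :=
  if `[< sigma a x >] then inf (tent x) else 0.

Let tent_inf x : has_inf (tent x).
Proof.
split; first by exists (Num.max 0 (1 - `|x 0%N - c 0%N| / e 0%N)); exists 0%N.
by exists 0 => _ [n _ <-]; rewrite le_max lexx.
Qed.

(** Only the tent of coordinate [k] changes, and it is Lipschitz with constant [1 / e k]; the bound
    passes to the infimum. *)
Let inf_tent_le x y k : (forall n, n != k -> x n = y n) ->
  inf (tent x) <= inf (tent y) + `|x k - y k| / e k.
Proof.
move=> xy; rewrite -lerBlDr; apply: lb_le_inf => [|_ [n _ <-]].
  exact: (proj1 (tent_inf y)).
rewrite lerBlDr; apply: (@le_trans _ _ (Num.max 0 (1 - `|x n - c n| / e n))).
  by apply: ge_inf; [exact: (proj2 (tent_inf x))|exists n].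
have d0 : 0 <= `|x k - y k| / e k by rewrite divr_ge0// ltW.
have [->|/xy ->] := eqVneq n k; last by rewrite lerDl.
rewrite ge_max; apply/andP; split.
  by apply: addr_ge0 => //; rewrite le_max lexx.
suff h : 1 - `|x k - c k| / e k <=
         (1 - `|y k - c k| / e k) + `|x k - y k| / e k.
  by apply: le_trans h _; rewrite lerD2r le_max lexx orbT.
have : `|y k - c k| / e k <= `|x k - c k| / e k + `|x k - y k| / e k.
  rewrite -mulrDl ler_pM2r ?invr_gt0//.
  by rewrite [leRHS]addrC (distrC (x k) (y k)); exact: ler_distD.
by lra.
Qed.

Lemma box_bump_replace_le b x k :
  `|box_bump x - box_bump (replace k b x)| <= `|x k - b k| / e k.
Proof.
have re n : n != k -> x n = replace k b x n by rewrite /replace => /negbTE ->.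
have rk : replace k b x k = b k by rewrite /replace eqxx.
(* Replacing one coordinate stays in the component, so both values fall under the same case. *)
have -> : box_bump (replace k b x) =
    if `[< sigma a x >] then inf (tent (replace k b x)) else 0.
  by rewrite /box_bump (asbool_equiv_eq (@sigma_replace R a b x k)).
rewrite /box_bump; case: ifP => _; last by rewrite subrr normr0 divr_ge0// ltW.
rewrite ler_distlC; apply/andP; split.
  by rewrite lerBlDr -rk; exact: inf_tent_le.
rewrite -rk distrC; apply: inf_tent_le => n nk; exact/esym/re.
Qed.

Lemma ssc_box_bump p : 0 < p -> strongly_separately_continuous p box_bump.
Proof.
move=> p0 b k pb; apply/cvgrPdist_lt => eps eps0.
have /cvgrPdist_lt/(_ (eps * e k)) := lp_nbhs_coord (k := k) p0 pb.
rewrite mulr_gt0// => /(_ isT); apply: filterS => x xb.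
rewrite sub0r normrN normr_id; apply: le_lt_trans (box_bump_replace_le b x k) _.
by rewrite ltr_pdivrMr// distrC.
Qed.

Lemma box_bump_center : sigma a c -> box_bump c != 0.
Proof.
move=> ac; rewrite /box_bump asboolT// gt_eqF//.
apply: (@lt_le_trans _ _ 1) => //.
apply: lb_le_inf => [|_ [n _ <-]]; first exact: (proj1 (tent_inf c)).
by rewrite subrr normr0 mul0r subr0 le_max lexx orbT.
Qed.

(** One coordinate outside its interval makes its tent zero, hence also the infimum of the
    nonnegative tents. *)
Lemma box_bump_support x : box_bump x != 0 ->
  sigma a x /\ forall n, `|x n - c n| <= e n.
Proof.
rewrite /box_bump; case: asboolP => [ax|_]; last by rewrite eqxx.
move=> fx; split=> // n; rewrite leNgt; apply: contra fx => xn.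
rewrite eq_le; apply/andP; split; last first.
  apply: lb_le_inf => [|_ [m _ <-]]; first exact: (proj1 (tent_inf x)).
  by rewrite le_max lexx.
apply: ge_inf; first exact: (proj2 (tent_inf x)).
exists n => //; apply/max_idPl.
by rewrite subr_le0 ler_pdivlMr// mul1r ltW.
Qed.

End BoxBump.

(** * Locally trivial test functions and the two implications *)

Lemma ssc_cst_replace {R : realType} (p : R) (f : (nat -> R) -> R) :
  (forall b x k, f (replace k b x) = f x) ->
  strongly_separately_continuous p f.
Proof.
move=> fr b k _; apply: cvg_near_cst; apply: nearW => x.
by rewrite fr subrr normr0.
Qed.

Unset Implicit Arguments.
Set Strict Implicit.

Theorem theorem2p7 (R : realType) (p : R) (hp : 1 <= p)
    (E : set (nat -> R)) (hE : E `<=` lp p) :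
  determining p E <->
  super_dense p E /\ (forall a : nat -> R, lp p a -> E `&` sigma a !=set0).
Proof.
have p0 : 0 < p by exact: lt_le_trans hp.
have ssc0 : strongly_separately_continuous p (fun=> 0 : R).
  exact: ssc_cst_replace.
have sigma_refl (a : nat -> R) : sigma a a by exact: (@eventually_sigma _ _ _ 0).
split=> [detE|[sdE meetE] f g sf sg fgE x px].
  split=> [a pa _|a pa]; last first.
    apply/set0P/eqP => Ea0.
    (* If [E] missed [sigma a], this indicator would agree with zero on [E] but not at [a]. *)
    pose f (x : nat -> R) : R := if `[< sigma a x >] then 1 else 0.
    have sf : strongly_separately_continuous p f.
      apply: ssc_cst_replace => b x k.
      by rewrite /f (asbool_equiv_eq (@sigma_replace R a b x k)).
    have fE x : E x -> f x = 0.
      move=> Ex; rewrite /f; case: asboolP => // ax.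
      by suff : set0 x by []; rewrite -Ea0.
    have := detE f _ sf ssc0 fE a pa; rewrite /f asboolT//.
    exact/eqP/oner_neq0.
  apply/seteqP; split=> [x []//|c ac]; split=> // W Wa oW Wc.
  have [e e0 eW] := nearly_open_box ac oW Wc.
  (* If [W] missed [E], the bump would vanish on [E], hence at [c]. *)
  apply: contrapT => WE; have /negP := box_bump_center e ac; apply.
  apply/eqP; apply: (detE _ _ (ssc_box_bump a c e0 p0) ssc0); last first.
    exact: sigma_lp ac.
  move=> x Ex; apply: contra_notP WE => /eqP /(box_bump_support e0)[ax xe].
  by exists x; split; [exact: eW|].
apply: contrapT => /eqP fgx.
(* The component is based at [x] itself, where [f] and [g] are assumed to differ. *)
have := sdE _ px (meetE _ px).
move=> /seteqP[_ /(_ x (sigma_refl x))][_ /(_ (sigma x `&` [set y | f y != g y]))].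
case.
- by move=> y [].
- exact: ssc_neq_nearly_open sf sg.
- by [].
- by move=> y [[_ /eqP fgy] [Ey _]]; apply: fgy; exact: fgE.
Qed.
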